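(* Let $\mathscr{A}=(G,\partial)$ and $\mathscr{A}'=(G,\partial')$ be unicyclizations of a connected graph $G$ such that $\operatorname{im}\partial=\operatorname{im}\partial'$. Let $\beta$ and $\beta'$ be bases of $Z_1(G)$. Then the winding number maps $w_{\mathscr{A}}(\cdot)=\det([\cdot]_\beta,[\partial]_\beta)$ relative to $\beta$ and $w_{\mathscr{A}'}(\cdot)=\det([\cdot]_{\beta'},[\partial']_{\beta'})$ relative to $\beta'$, as functions $Z_1(G)\to\mathbb{Z}$, are the same up to sign. Moreover $H_1(\mathscr{A})=H_1(\mathscr{A}')$.
   Context: Graphs are finite and connected; loops and multiple edges are allowed. Fix an orientation of each edge. $\partial_1:\mathbb{Z}^{E(G)}\to\mathbb{Z}^{V(G)}$ is the (oriented) incidence matrix (a loop gives a zero column). $Z_1(G)=\ker\partial_1$ is a free abelian group of rank $m=|E(G)|-|V(G)|+1$; bases are (ordered) $\mathbb{Z}$-bases. A unicyclizer of $G$ is an integer matrix $\partial$ (rows indexed by $E(G)$) with (1) $\ker\partial=0$, (2) $\partial_1\partial=0$, (3) $\operatorname{rk}(\ker\partial_1/\operatorname{im}\partial)=1$. So $\partial$ has $m-1$ linearly independent columns, all in $Z_1(G)$. The pair $\mathscr{A}=(G,\partial)$ is called a unicyclization of $G$, and $H_1(\mathscr{A})=\ker\partial_1/\operatorname{im}\partial$, where $\operatorname{im}\partial$ is the integral image. For a basis $\beta$ of $Z_1(G)$, $[z]_\beta\in\mathbb{Z}^m$ is the coordinate column vector of $z\in Z_1(G)$, $[\partial]_\beta$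 is the $m\times(m-1)$ matrix whose columns are the coordinate vectors of the columns of $\partial$, and $([z]_\beta,[\partial]_\beta)$ is the $m\times m$ matrix with first column $[z]_\beta$. *)

(* Defs.v *)
(* boolp only decides membership in the image of an integer matrix. *)
From HB Require Import structures.
From mathcomp Require Import all_boot all_order all_algebra.
From mathcomp Require Import generic_quotient ring_quotient.
From mathcomp Require Import boolp.

Set Implicit Arguments.
Unset Strict Implicit.
Unset Printing Implicit Defensive.

Import Order.TTheory GRing.Theory Num.Theory.
Local Open Scope ring_scope.

Section AbelianGroups.
Variable M : zmodType.

Definition zindependent (r : nat) (x : 'I_r -> M) : Prop :=
  forall c : 'I_r -> int, \sum_(i < r) x i *~ c i = 0 -> forall i, c i = 0.

(* The rank is the maximal size of a Z-independent family; torsion is allowed. *)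
Definition has_rank (r : nat) : Prop :=
  (exists x : 'I_r -> M, zindependent x) /\
  (forall (s : nat) (x : 'I_s -> M), zindependent x -> (s <= r)%N).

Record zbasis : Type := ZBasis {
  zbasis_size : nat;
  zbasis_vec :> 'I_zbasis_size -> M;
  zbasis_free : zindependent zbasis_vec;
  zbasis_span : forall z : M, exists c : 'cV[int]_zbasis_size,
                  \sum_i zbasis_vec i *~ c i 0 == z }.

Definition coord (b : zbasis) (z : M) : 'cV[int]_(zbasis_size b) :=
  xchoose (zbasis_span b z).

Lemma coordK (b : zbasis) (z : M) : \sum_i b i *~ coord b z i 0 = z.
Proof. exact/eqP/(xchooseP (zbasis_span b z)). Qed.

Lemma coord_unique (b : zbasis) (z : M) (c : 'cV[int]_(zbasis_size b)) :
  \sum_i b i *~ c i 0 = z -> c = coord b z.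
Proof.
move=> cz; apply/colP=> i; apply/eqP; rewrite -subr_eq0; apply/eqP.
apply: (zbasis_free (c := fun i => c i 0 - coord b z i 0)).
under eq_bigr => j _ do rewrite mulrzBr.
by rewrite sumrB cz coordK subrr.
Qed.

(* A quotient of M is a group together with its projection from M, so that
   Leibniz equality of two quotients identifies the groups compatibly with the
   projections, which is stronger than the existence of an isomorphism. *)
Record zquotient : Type := ZQuotient {
  zquot_sort :> zmodType;
  zquot_pi : {additive M -> zquot_sort} }.

Definition quotient_by (I : zmodClosed M) : zquotient :=
  @ZQuotient {ideal_quot I} \pi_{ideal_quot I}%qT.

End AbelianGroups.

(* Finite multigraph with a chosen orientation; loops (src e = tgt e) and
   parallel edges are allowed. *)
Record multigraph : Type := Multigraph {
  vertex : finType;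
  edge : finType;
  src : edge -> vertex;
  tgt : edge -> vertex }.

Definition adjacent (G : multigraph) : rel (vertex G) :=
  fun u v => [exists e : edge G,
    ((src e == u) && (tgt e == v)) || ((src e == v) && (tgt e == u))].

Definition connected (G : multigraph) : Prop :=
  (0 < #|vertex G|)%N /\ forall u v : vertex G, connect (@adjacent G) u v.

Definition boundary1 (G : multigraph) : 'M[int]_(#|vertex G|, #|edge G|) :=
  \matrix_(i, j) ((tgt (enum_val j) == enum_val i)%:R
                  - (src (enum_val j) == enum_val i)%:R).

Section Cycles.
Variable G : multigraph.

Definition is_cycle : {pred 'cV[int]_#|edge G|} :=
  fun z => boundary1 G *m z == 0.

Lemma is_cycle_zmod_closed : zmod_closed is_cycle.
Proof.
split=> [|x y]; rewrite !unfold_in ?mulmx0 // => /eqP dx /eqP dy.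
by rewrite mulmxBr dx dy subrr.
Qed.

HB.instance Definition _ :=
  GRing.isZmodClosed.Build 'cV[int]_#|edge G| is_cycle is_cycle_zmod_closed.

Record Z1 : Type := Cycle {
  chain_of :> 'cV[int]_#|edge G|;
  _ : chain_of \in is_cycle }.

HB.instance Definition _ := [isSub for chain_of].
HB.instance Definition _ := [Choice of Z1 by <:].
HB.instance Definition _ := [SubChoice_isSubZmodule of Z1 by <:].

Section Image.
Variables (k : nat) (D : 'M[int]_(#|edge G|, k)).

Definition im : {pred Z1} :=
  fun z => `[< exists c : 'cV[int]_k, chain_of z = D *m c >].

Lemma im_zmod_closed : zmod_closed im.
Proof.
split=> [|x y]; rewrite !unfold_in.
  by apply/asboolP; exists 0; rewrite mulmx0.
move=> /asboolP[a xa] /asboolP[b yb]; apply/asboolP; exists (a - b).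
by rewrite mulmxBr -xa -yb.
Qed.

HB.instance Definition _ := GRing.isZmodClosed.Build Z1 im im_zmod_closed.

Definition H1 : zquotient Z1 := quotient_by im.

End Image.

(* A unicyclization of G: a unicyclizer, with no a priori constraint on its
   number of columns. *)
Record unicyclization : Type := Unicyclization {
  ncols : nat;
  unicyclizer :> 'M[int]_(#|edge G|, ncols);
  unicyclizer_ker : forall c : 'cV[int]_ncols, unicyclizer *m c = 0 -> c = 0;
  unicyclizer_cycle : boundary1 G *m unicyclizer = 0;
  unicyclizer_rank : has_rank (H1 unicyclizer) 1%N }.

Lemma col_is_cycle (A : unicyclization) (j : 'I_(ncols A)) :
  col j A \in is_cycle.
Proof. by rewrite unfold_in colE mulmxA unicyclizer_cycle mul0mx. Qed.

Definition col_cycle (A : unicyclization) (j : 'I_(ncols A)) : Z1 :=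
  Cycle (col_is_cycle j).

Definition coord_mx (b : zbasis Z1) (A : unicyclization) :
    'M[int]_(zbasis_size b, ncols A) :=
  \matrix_(i, j) coord b (col_cycle j) i 0.

End Cycles.

Lemma int_wide_ker (n k : nat) (C : 'M[int]_(n, k)) :
  (n < k)%N -> exists2 c : 'cV[int]_k, c != 0 & C *m c = 0.
Proof.
move=> lt_nk; have [L _ [R uR [d _ ->]]] := int_Smith_normal_form C.
pose j := Ordinal lt_nk.
exists (invmx R *m delta_mx j 0).
  apply/eqP => /(congr1 (mulmx R)); rewrite mulmx0 mulKVmx // => /matrixP/(_ j 0).
  by rewrite !mxE !eqxx.
rewrite -!mulmxA mulKVmx // -colE.
set v := col _ _; suff ->: v = 0 by rewrite mulmx0.
apply/colP=> i; rewrite !mxE /=; have := ltn_ord i.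
by case: eqP => [-> | _ _]; rewrite ?ltnn ?mulr0n.
Qed.

Lemma int_tall_coker (n k s : nat) (C : 'M[int]_(n, k)) : (k + s <= n)%N ->
  exists B : 'M[int]_(n, s), forall (a : 'cV[int]_s) (c : 'cV[int]_k),
    B *m a = C *m c -> a = 0.
Proof.
move=> le_n; have [L uL [R _ [d _ ->]]] := int_Smith_normal_form C.
exists (L *m \matrix_(i, j) (i == k + j :> nat)%N%:R) => a c.
rewrite -!mulmxA => /(congr1 (mulmx (invmx L))); rewrite !mulKmx //.
move: (R *m c) => {R}c eq_ac; apply/colP=> j.
have lt_j : (k + j < n)%N by apply: leq_trans le_n; rewrite ltn_add2l.
move/matrixP/(_ (Ordinal lt_j) 0): eq_ac; rewrite !mxE.
rewrite (bigD1 j) //= !mxE eqxx mul1r big1 => [|i /negPf ne_ij]; last first.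
  by rewrite mxE eqn_add2l eq_sym (inj_eq val_inj) ne_ij mul0r.
rewrite addr0 => ->; rewrite big1 // => i _; rewrite mxE /=.
by rewrite gtn_eqF ?mulr0n ?mul0r // (leq_trans (ltn_ord i)) ?leq_addr.
Qed.

Lemma zbasis_comb (M : zmodType) (b : zbasis M) (s : nat) (x : 'I_s -> M)
    (C : 'M[int]_(zbasis_size b, s)) (c : 'cV[int]_s) :
  (forall j, x j = \sum_i b i *~ C i j) ->
  \sum_j x j *~ c j 0 = \sum_i b i *~ (C *m c) i 0.
Proof.
move=> xC; under eq_bigr => j _ do rewrite xC mulrz_suml.
rewrite exchange_big; apply: eq_bigr => i _; rewrite mxE mulrz_sumr.
by apply: eq_bigr => j _; rewrite mulrzA.
Qed.

Lemma zindependent_size (M : zmodType) (b : zbasis M) (s : nat) (x : 'I_s -> M) :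
  zindependent x -> (s <= zbasis_size b)%N.
Proof.
move=> indx; rewrite leqNgt; apply/negP.
move/(int_wide_ker (\matrix_(i, j) coord b (x j) i 0)) => [c nz_c Cc0].
case/eqP: nz_c; apply/colP=> j; rewrite mxE; apply: indx (fun j => c j 0) _ j.
rewrite (zbasis_comb (b := b) c (C := \matrix_(i, j) coord b (x j) i 0)).
  by rewrite Cc0 big1 // => i _; rewrite mxE mulr0z.
by move=> j; under eq_bigr => i _ do rewrite mxE; rewrite coordK.
Qed.

Lemma H1_pi_eq0 (G : multigraph) (k : nat) (D : 'M[int]_(#|edge G|, k)) (z : Z1 G) :
  (zquot_pi (H1 D) z == 0) = (z \in im D).
Proof.
rewrite -(raddf0 (zquot_pi (H1 D))) /= -Quotient.idealrBE subr0; exact: erefl.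
Qed.

Lemma chain_comb (G : multigraph) (A : unicyclization G) (c : 'cV[int]_(ncols A)) :
  chain_of (\sum_j col_cycle j *~ c j 0) = A *m c.
Proof.
rewrite [LHS](raddf_sum (val : Z1 G -> _)); apply/colP=> i.
rewrite summxE mxE; apply: eq_bigr => j _.
by rewrite (raddfMz (val : Z1 G -> _)) -scaler_int !mxE intz mulrC.
Qed.

Lemma unicyclization_size (G : multigraph) (b : zbasis (Z1 G)) (A : unicyclization G) :
  (1 + ncols A)%N = zbasis_size b.
Proof.
have [[x indx] max_ind] := unicyclizer_rank A.
apply/eqP; rewrite eqn_leq; apply/andP; split.
  pose z := repr (x ord0 : {ideal_quot (im A)}).
  have xz : x ord0 = zquot_pi (H1 A) z by rewrite /= reprK.
  pose y (j : 'I_(1 + ncols A)) :=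
    if split j is inr j' then col_cycle j' else z.
  apply: (@zindependent_size _ b _ y) => c.
  rewrite big_split_ord /= big_ord1 => sum0.
  have yl : y (lshift _ ord0) = z.
    by rewrite /y; case: splitP => // j /= /eqP; rewrite eq_sym.
  have yr j : y (rshift 1 j) = col_cycle j.
    rewrite /y; case: splitP => [j' /= e|j' /= [e]].
      by have := ltn_ord j'; rewrite -e.
    by congr col_cycle; apply: val_inj.
  rewrite yl in sum0; have {}sum0 : z *~ c (lshift _ ord0) + \sum_j col_cycle j *~ c (rshift 1 j) = 0.
    by rewrite -[RHS]sum0; congr (_ + _); apply: eq_bigr => j _; rewrite yr.
  pose a : 'cV[int]_(ncols A) := \col_j c (rshift 1 j).
  have sumE : \sum_j col_cycle j *~ c (rshift 1 j) = \sum_j col_cycle j *~ a j 0.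
    by apply: eq_bigr => j _; rewrite mxE.
  have c0 : c (lshift _ ord0) = 0.
    apply: (indx (fun=> c (lshift _ ord0))) ord0.
    rewrite big_ord1 xz -raddfMz; apply/eqP; rewrite H1_pi_eq0.
    move/eqP: sum0; rewrite addr_eq0 sumE => /eqP ->.
    rewrite rpredN; apply/asboolP; exists a; exact: chain_comb.
  move: sum0; rewrite c0 mulr0z add0r sumE => /(congr1 (@chain_of G)).
  rewrite chain_comb => /unicyclizer_ker a0 i.
  case: (split_ordP i) => j ->; first by rewrite ord1.
  by move/colP/(_ j): a0; rewrite !mxE.
rewrite leqNgt; apply/negP => lt_n.
have le_n : (ncols A + 2 <= zbasis_size b)%N by rewrite addnC.
have [B injB] := int_tall_coker (coord_mx b A) le_n.
pose w (j : 'I_2) := \sum_i b i *~ B i j.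
suff /max_ind : zindependent (fun j => zquot_pi (H1 A) (w j)) by [].
move=> c; under eq_bigr => j _ do rewrite -raddfMz.
rewrite -raddf_sum => /eqP; rewrite H1_pi_eq0 => /asboolP[a].
rewrite -chain_comb => /val_inj.
pose c' : 'cV[int]_2 := \col_j c j.
have -> : \sum_j w j *~ c j = \sum_j w j *~ c' j 0.
  by apply: eq_bigr => j _; rewrite mxE.
rewrite (zbasis_comb (C := B)) // (zbasis_comb (b := b) (C := coord_mx b A)); last first.
  by move=> j; under eq_bigr => i _ do rewrite mxE; rewrite coordK.
move=> eqBC; suff /injB /colP c0 : B *m c' = coord_mx b A *m a.
  by move=> j; have := c0 j; rewrite !mxE.
by rewrite (coord_unique eqBC) -(coord_unique erefl).
Qed.

(* The matrix ([z]_b, [A]_b) has zbasis_size b rows and 1 + ncols A columns;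
   these agree, but only propositionally. *)
Definition winding_mx (G : multigraph) (A : unicyclization G) (b : zbasis (Z1 G))
    (z : Z1 G) : 'M[int]_(zbasis_size b) :=
  castmx (erefl _, unicyclization_size b A)
    (row_mx (coord b z) (coord_mx b A)).

Definition winding_number (G : multigraph) (A : unicyclization G)
    (b : zbasis (Z1 G)) (z : Z1 G) : int :=
  \det (winding_mx A b z).

(* Main.v *)
(* Passing from b to b' multiplies ([z]_b, [A]_b) on the left by a change of
   basis P, and since A and A' have the same integral image, A' = A C with C
   invertible over int, which acts on the right as diag(1, C).  Hence the two
   determinants differ by the factor det P * det C, a unit of int. *)
From mathcomp Require Import all_boot all_order all_algebra.
From mathcomp Require Import boolp.
Require Import Defs.
Set Implicit Arguments.
Unset Strict Implicit.
Unset Printing Implicit Defensive.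

Import GRing.Theory.
Local Open Scope ring_scope.

Lemma det_int_unit (n : nat) (B C : 'M[int]_n) :
  B *m C = 1%:M -> \det B = 1 \/ \det B = -1.
Proof.
by move=> /mulmx1_unit[]; rewrite unitmxE => /orP[]/eqP -> _; [left | right].
Qed.

(** The sizes agree only propositionally, so they stay separate variables that the proof can
    identify before removing both casts. *)
Lemma det_row_mx_change (n n' k k' : nat) (e : (1 + k = n)%N)
    (e' : (1 + k' = n')%N) (P : 'M[int]_(n', n)) (P' : 'M[int]_(n, n'))
    (C : 'M[int]_(k, k')) (C' : 'M[int]_(k', k)) :
  n = n' -> P *m P' = 1%:M -> C *m C' = 1%:M ->
  exists2 s : int, s = 1 \/ s = -1 &
    forall (v : 'cV[int]_n) (N : 'M[int]_(n, k)),
      \det (castmx (erefl _, e) (row_mx v N)) =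
      s * \det (castmx (erefl _, e') (row_mx (P *m v) (P *m N *m C))).
Proof.
(* This makes [C] and [P] square, so that they have determinants. *)
move=> nn'; have kk' : k = k' by apply: (@addnI 1); rewrite e e'.
subst k'; case: _ / nn' e' P P' => e' P P'; subst n.
rewrite (eq_irrelevance e' erefl) => PP' CC'.
exists (\det P * \det C) => [|v N].
  by case: (det_int_unit PP') (det_int_unit CC') => -> [] ->;
    rewrite ?mulrN ?mulNr ?mulr1 ?opprK; [left | right | right | left].
(* A sign is its own inverse, so the factor can stand on either side of the identity. *)
have ss1 : (\det P * \det C) * (\det P * \det C) = 1.
  by case: (det_int_unit PP') (det_int_unit CC') => -> [] ->.
rewrite !castmx_id.
have -> : row_mx (P *m v) (P *m N *m C) =
    P *m row_mx v N *m block_mx 1%:M 0 0 C.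
  by rewrite mul_mx_row mul_row_block !mulmx0 mulmx1 addr0 add0r.
rewrite !det_mulmx det_ublock det1 mul1r.
by rewrite [X in _ * X]mulrAC [RHS]mulrA ss1 mul1r.
Qed.

Section ChangeOfBasis.
Variables (M : zmodType) (b b' : zbasis M).

Definition basis_change : 'M[int]_(zbasis_size b', zbasis_size b) :=
  \matrix_(i, j) coord b' (b j) i 0.

Lemma coord_change (z : M) : coord b' z = basis_change *m coord b z.
Proof.
apply/esym/coord_unique; rewrite -(zbasis_comb (x := b)) ?coordK // => j.
by rewrite -[LHS](coordK b'); apply: eq_bigr => i _; rewrite mxE.
Qed.

Lemma zbasis_size_eq : zbasis_size b = zbasis_size b'.
Proof.
by apply/eqP; rewrite eqn_leq !(zindependent_size _ (@zbasis_free _ _)).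
Qed.

End ChangeOfBasis.

Lemma coord_basis (M : zmodType) (b : zbasis M) j : coord b (b j) = delta_mx j 0.
Proof.
apply/esym/coord_unique; rewrite (bigD1 j) //= mxE !eqxx mulr1z.
by rewrite big1 ?addr0 // => i /negPf ne; rewrite mxE ne mulr0z.
Qed.

(** Column [j] of the product is [coord b (b j)], the [j]-th unit vector. *)
Lemma basis_changeK (M : zmodType) (b b' : zbasis M) :
  basis_change b' b *m basis_change b b' = 1%:M.
Proof.
apply/matrixP => i j.
have -> : (basis_change b' b *m basis_change b b') i j =
          (basis_change b' b *m coord b' (b j)) i 0.
  by rewrite !mxE; apply: eq_bigr => l _; rewrite !mxE.
by rewrite -coord_change coord_basis !mxE andbT.
Qed.

Section Unicyclizations.
Variable G : multigraph.
Implicit Types (A : unicyclization G) (b : zbasis (Z1 G)).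

Lemma coord_mx_change A b b' :
  coord_mx b' A = basis_change b b' *m coord_mx b A.
Proof.
apply/matrixP => i j; rewrite mxE (coord_change b) !mxE.
by apply: eq_bigr => l _; rewrite !mxE.
Qed.

(** Column [j] of [C] expresses the [j]-th cycle of [A'] through those of [A]; uniqueness of
    coordinates transfers this relation to coordinate vectors. *)
Lemma coord_mx_mulmx A A' b (C : 'M[int]_(ncols A, ncols A')) :
  unicyclizer A' = A *m C -> coord_mx b A' = coord_mx b A *m C.
Proof.
move=> A'C; apply/matrixP => i j; rewrite mxE.
suff <- : coord_mx b A *m col j C = coord b (col_cycle j).
  by rewrite !mxE; apply: eq_bigr => l _; rewrite !mxE.
apply: coord_unique.
rewrite -(zbasis_comb (b := b) (x := @col_cycle G A)); last first.
  by move=> l; under eq_bigr => h _ do rewrite mxE; rewrite coordK.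
by apply: val_inj; rewrite /= chain_comb A'C !colE mulmxA.
Qed.

(** Each column of [A'] lies in [im A'], hence is [A] times an integer vector; a choice of one such
    vector per column assembles [C]. *)
Lemma sub_im_factor A A' :
  {subset im A' <= im A} -> exists C, unicyclizer A' = A *m C.
Proof.
move=> sub.
have fac (j : 'I_(ncols A')) : exists c : 'cV[int]_(ncols A), col j A' = A *m c.
  apply/asboolP/(sub (col_cycle j)); apply/asboolP.
  by exists (delta_mx j 0); rewrite /= colE.
have [c cP] := fin_all_exists fac.
exists (\matrix_(i, j) c j i 0); apply/matrixP => i j.
move/colP/(_ i): (cP j); rewrite !mxE => ->.
by apply: eq_bigr => l _; rewrite mxE.
Qed.

(** Every column of [C - 1] lies in the kernel of [A], which is trivial. *)
Lemma unicyclizer_mulmx1 A (C : 'M[int]_(ncols A)) :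
  unicyclizer A = A *m C -> C = 1%:M.
Proof.
move=> AC; apply/eqP; rewrite -subr_eq0; apply/eqP/matrixP => i j.
have /unicyclizer_ker/colP/(_ i) : A *m col j (C - 1%:M) = 0.
  by rewrite colE mulmxA mulmxBr mulmx1 -AC subrr mul0mx.
by rewrite !mxE.
Qed.

(** Besides its predicate, the structure holds only proofs, which are equal by proof irrelevance.
    This allows Leibniz equality of the quotients, not just an isomorphism. *)
Lemma zmodClosed_ext (M : zmodType) (I J : zmodClosed M) :
  (I : {pred M}) = J -> I = J.
Proof.
case: I J => [P cP] [Q cQ] /= PQ; case: _ / PQ cQ => cQ.
congr GRing.ZmodClosed.Pack.
case: cP cQ => [[a] [c]] [[a'] [c']].
by rewrite (Prop_irrelevance a a') (Prop_irrelevance c c').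
Qed.

Lemma H1_ext k k' (D : 'M[int]_(#|edge G|, k)) (D' : 'M[int]_(#|edge G|, k')) :
  im D =i im D' -> H1 D = H1 D'.
Proof.
move=> eq_im; congr quotient_by; apply: zmodClosed_ext.
by apply: funext => z; apply: eq_im.
Qed.

End Unicyclizations.

Theorem proposition4p4p1 (G : multigraph) (A A' : unicyclization G)
    (b b' : zbasis (Z1 G)) :
  connected G ->
  im A =i im A' ->
  ((forall z : Z1 G, winding_number A b z = winding_number A' b' z) \/
   (forall z : Z1 G, winding_number A b z = - winding_number A' b' z)) /\
  H1 A = H1 A'.
Proof.
move=> _ eq_im; split; last exact: H1_ext.
have [C A'C] : exists C, unicyclizer A' = A *m C.
  by apply: sub_im_factor => z; rewrite eq_im.
have [C' AC'] : exists C', unicyclizer A = A' *m C'.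
  by apply: sub_im_factor => z; rewrite eq_im.
(* Substituting one factorization into the other gives [A = A C C'], and [A] cancels on the left. *)
have CC' : C *m C' = 1%:M by apply: unicyclizer_mulmx1; rewrite mulmxA -A'C.
(* Here [P] is [basis_change b b'], which turns [b]-coordinates into [b']-coordinates. *)
have [s s1 detE] := det_row_mx_change (unicyclization_size b A)
  (unicyclization_size b' A') (zbasis_size_eq b b') (basis_changeK b' b) CC'.
have wE z : winding_number A b z = s * winding_number A' b' z.
  rewrite /winding_number /winding_mx detE -coord_change -coord_mx_change.
  by rewrite -(coord_mx_mulmx _ A'C).
by case: s1 wE => -> wE; [left | right] => z; rewrite wE ?mul1r ?mulN1r.
Qed.
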